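(* Let $M\in\mathbb{R}^{m\times n}$ be a nonzero matrix. Let $f:\mathbb{R}^n\to\left]-\infty,+\infty\right]$ be proper, lower semicontinuous and $\alpha$-convex, and let $g:\mathbb{R}^m\to\left]-\infty,+\infty\right]$ be proper, lower semicontinuous and $\beta$-convex, where $\alpha,\beta\in\mathbb{R}$ satisfy $\alpha\ge 0$ and $\alpha+\beta\|M\|^2\ge 0$. Suppose that the Lagrangian $L_0$ has a critical point and that $0\in\operatorname{ri}(\operatorname{dom} f^*-\operatorname{ran} M^T)$. Let $\delta>\max\{0,-2\beta\}$ and let $\gamma$ be such that $$\gamma=\delta+2\beta\quad\text{if }\alpha+\beta\|M\|^2=0,$$ $$\gamma\in\left]\max\{0,\delta+2\beta-\Delta_\delta\},\ \delta+2\beta+\Delta_\delta\right[\quad\text{if }\alpha+\beta\|M\|^2>0,$$ where $\Delta_\delta:=\frac{1}{\|M\|}\sqrt{2(\alpha+\beta\|M\|^2)(\delta+2\beta)}$. Let $(x^0,z^0,y^0)\in\mathbb{R}^n\times\mathbb{R}^m\times\mathbb{R}^m$ and let $(x^k,z^k,y^k)_{k=0}^\infty$ be generated by the aADMM with parameters $\gamma,\delta$. Then $$Mx^k\to Mx^\star,\quad z^k\to z^\star\quad\text{and}\quad y^k\to y^\star,$$ where $(x^\star,z^\star,y^\star)$ is a critical point of $L_0$. Consequently, $(x^\star,z^\star)$ is a solution of the problem $\min\{f(x)+g(z): Mx=z,\ x\in\mathbb{R}^n,\ z\in\mathbb{R}^m\}$.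
   Context: $\|M\|$ is the matrix $2$-norm. A function $h$ is $\alpha$-convex ($\alpha\in\mathbb{R}$) if $h-\frac{\alpha}{2}\|\cdot\|^2$ is convex. $\operatorname{dom} h=\{x:h(x)<+\infty\}$; $f^*(u)=\sup_x\{\langle u,x\rangle-f(x)\}$ is the Fenchel conjugate; $\operatorname{ri}$ is the relative interior; $\operatorname{ran}$ is the range. For $\gamma\ge 0$ the augmented Lagrangian is $L_\gamma(x,z,y)=f(x)+g(z)+\langle y,Mx-z\rangle+\frac{\gamma}{2}\|Mx-z\|^2$; $L_0$ is the (unaugmented) Lagrangian. Convex subdifferential: $\partial f(x)=\{u:\langle y-x,u\rangle+f(x)\le f(y)\ \forall y\}$ for $x\in\operatorname{dom} f$. Fréchet subdifferential: $\widehat\partial g(z)=\{u:\liminf_{w\to z,\,w\ne z}\frac{g(w)-g(z)-\langle u,w-z\rangle}{\|w-z\|}\ge 0\}$ for $z\in\operatorname{dom} g$. Both are empty outside the domain. A triple $(x^\star,z^\star,y^\star)\in\mathbb{R}^n\times\mathbb{R}^m\times\mathbb{R}^m$ is a critical point of $L_0$ if $-M^Ty^\star\in\partial f(x^\star)$, $y^\star\in\widehat\partial g(z^\star)$ and $Mx^\star-z^\star=0$. The aADMM (adaptive alternating direction method of multipliers) with parameters $\gamma,\delta>0$ and initial point $(x^0,z^0,y^0)$ iterates, for $k=0,1,2,\dots$: $x^{k+1}$ is a minimizer of $x\mapsto L_\gamma(x,z^k,y^k)$ over $\mathbb{R}^n$; $z^{k+1}$ is a minimizer of $z\mapsto L_\delta(x^{k+1},z,y^k)$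 over $\mathbb{R}^m$; $y^{k+1}=y^k+\delta(Mx^{k+1}-z^{k+1})$.
   Formalization: In the x-step the constant term g(z^k) is dropped from the augmented Lagrangian; this changes nothing when g(z^k) is finite, but if g(z^0) = +∞ the literal objective is identically +∞, every x is a minimizer, and the claim fails. *)

(* Defs.v *)
From mathcomp Require Import all_boot all_order all_algebra.
From mathcomp Require Import all_classical all_reals all_analysis.

Set Implicit Arguments.
Unset Strict Implicit.
Unset Printing Implicit Defensive.

Import Order.TTheory GRing.Theory Num.Theory.
Import numFieldNormedType.Exports.

Local Open Scope classical_set_scope.
Local Open Scope ring_scope.

(* The library norm `|_| on matrices is the sup norm, hence the explicit
   Euclidean structure.  Limits use the library topology on 'cV[R]_n, which is
   the Euclidean one. *)

Definition dot (R : realType) (n : nat) (u v : 'cV[R]_n) : R :=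
  \sum_(i < n) u i 0 * v i 0.

Definition enorm (R : realType) (n : nat) (u : 'cV[R]_n) : R :=
  Num.sqrt (dot u u).

Definition norm2 (R : realType) (m n : nat) (M : 'M[R]_(m, n)) : R :=
  sup [set enorm (M *m x) | x in [set x : 'cV[R]_n | enorm x <= 1]].

(* Functions into ]-oo, +oo] are functions into \bar R that avoid -oo; this
   requirement is part of [proper_fun]. *)

Definition dom (R : realType) (n : nat) (h : 'cV[R]_n -> \bar R) :
    set 'cV[R]_n :=
  [set x | (h x < +oo)%E].

Definition proper_fun (R : realType) (n : nat) (h : 'cV[R]_n -> \bar R) : Prop :=
  (forall x, h x != -oo%E) /\ dom h !=set0.

Definition econvex (R : realType) (n : nat) (h : 'cV[R]_n -> \bar R) : Prop :=
  forall (x y : 'cV[R]_n) (t : R), 0 < t < 1 ->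
    (h (t *: x + (1 - t) *: y)%R <= t%:E * h x + (1 - t)%:E * h y)%E.

Definition alpha_convex (R : realType) (n : nat) (alpha : R)
    (h : 'cV[R]_n -> \bar R) : Prop :=
  econvex (fun x => (h x - (alpha / 2 * enorm x ^+ 2)%:E)%E).

Definition fenchel (R : realType) (n : nat) (f : 'cV[R]_n -> \bar R)
    (u : 'cV[R]_n) : \bar R :=
  ereal_sup [set ((dot u x)%:E - f x)%E | x in [set: 'cV[R]_n]].

Definition affine_set (R : realType) (n : nat) (A : set 'cV[R]_n) : Prop :=
  forall (x y : 'cV[R]_n) (t : R), A x -> A y -> A (t *: x + (1 - t) *: y).

Definition affine_hull (R : realType) (n : nat) (C : set 'cV[R]_n) :
    set 'cV[R]_n :=
  [set x | forall A : set 'cV[R]_n, affine_set A -> C `<=` A -> A x].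

Definition ri (R : realType) (n : nat) (C : set 'cV[R]_n) : set 'cV[R]_n :=
  [set x | C x /\ \forall w \near x, affine_hull C w -> C w].

Definition ran (R : realType) (m n : nat) (A : 'M[R]_(m, n)) : set 'cV[R]_m :=
  range (fun x : 'cV[R]_n => A *m x).

Definition minkowski_sub (R : realType) (n : nat) (A B : set 'cV[R]_n) :
    set 'cV[R]_n :=
  [set u - v | u in A & v in B].

Definition subdiff (R : realType) (n : nat) (f : 'cV[R]_n -> \bar R)
    (x : 'cV[R]_n) : set 'cV[R]_n :=
  [set u | dom f x /\ forall y, ((dot (y - x) u)%:E + f x <= f y)%E].

Definition frechet_subdiff (R : realType) (m : nat) (g : 'cV[R]_m -> \bar R)
    (z : 'cV[R]_m) : set 'cV[R]_m :=
  [set u | dom g z /\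
    (0 <= limf_einf
            (fun w : 'cV[R]_m =>
               (g w - g z - (dot u (w - z))%:E) * ((enorm (w - z))^-1)%:E)
            z^')%E].

Definition critical_point (R : realType) (m n : nat)
    (f : 'cV[R]_n -> \bar R) (g : 'cV[R]_m -> \bar R) (M : 'M[R]_(m, n))
    (x : 'cV[R]_n) (z y : 'cV[R]_m) : Prop :=
  [/\ subdiff f x (- (M^T *m y)), frechet_subdiff g z y & M *m x - z = 0].

Definition augL (R : realType) (m n : nat)
    (f : 'cV[R]_n -> \bar R) (g : 'cV[R]_m -> \bar R) (M : 'M[R]_(m, n))
    (gamma : R) (x : 'cV[R]_n) (z y : 'cV[R]_m) : \bar R :=
  (f x + g z + (dot y (M *m x - z))%:E
   + (gamma / 2 * enorm (M *m x - z) ^+ 2)%:E)%E.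

Definition minimizer (R : realType) (n : nat) (phi : 'cV[R]_n -> \bar R)
    (x : 'cV[R]_n) : Prop :=
  forall w, (phi x <= phi w)%E.

(* In the x-step the term g (z k), constant in x, is dropped (g is replaced by
   0).  This changes nothing when g (z k) is finite, which always holds for
   k > 0.  But z0 is arbitrary: if g z0 = +oo, then keeping the term would make
   the objective identically +oo and every point a minimizer. *)
Definition aADMM (R : realType) (m n : nat)
    (f : 'cV[R]_n -> \bar R) (g : 'cV[R]_m -> \bar R) (M : 'M[R]_(m, n))
    (gamma delta : R) (x0 : 'cV[R]_n) (z0 y0 : 'cV[R]_m)
    (x : nat -> 'cV[R]_n) (z y : nat -> 'cV[R]_m) : Prop :=
  [/\ x 0%N = x0, z 0%N = z0, y 0%N = y0 &
      forall k : nat,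
        [/\ minimizer (fun w => augL f (cst 0%E) M gamma w (z k) (y k))
                      (x k.+1),
            minimizer (fun w => augL f g M delta (x k.+1) w (y k)) (z k.+1) &
            y k.+1 = y k + delta *: (M *m x k.+1 - z k.+1)]].

Definition Delta (R : realType) (m n : nat) (M : 'M[R]_(m, n))
    (alpha beta delta : R) : R :=
  (norm2 M)^-1 *
  Num.sqrt (2 * (alpha + beta * norm2 M ^+ 2) * (delta + 2 * beta)).

Definition solution (R : realType) (m n : nat)
    (f : 'cV[R]_n -> \bar R) (g : 'cV[R]_m -> \bar R) (M : 'M[R]_(m, n))
    (xs : 'cV[R]_n) (zs : 'cV[R]_m) : Prop :=
  M *m xs = zs /\
  forall (x : 'cV[R]_n) (z : 'cV[R]_m), M *m x = z ->
    (f xs + g zs <= f x + g z)%E.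

(* Main.v *)
(* With [s k = y k + delta *: z k], the two optimality conditions make the
   algorithm an adaptive Douglas-Rachford iteration
   [s k.+1 = s k + delta *: r], [r = M *m x k.+1 - z k].  For any critical point
   [(xc, zc, yc)] and [a = alpha / norm2 M ^+ 2], monotonicity of the
   subdifferentials shows that [V = |s k - (yc + delta *: zc)|^2] decreases by
   at least [2 * delta] times a quadratic form in [z k - zc] and [r]; the condition
   on [gamma] says exactly that this form dominates a positive multiple of
   [|r|^2].  Hence [r] tends to 0 and [(z k, y k)] is bounded, and every cluster
   point [(zs, ys)] extends to a critical point because the relative interior
   condition provides the missing [xs].  Applying the decrease of [V] to that
   critical point gives convergence of the whole sequence. *)
Require Import Defs.
From mathcomp Require Import all_boot all_order all_algebra.
From mathcomp Require Import all_classical all_reals all_analysis.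
From mathcomp Require Import ring lra.

Set Implicit Arguments.
Unset Strict Implicit.
Unset Printing Implicit Defensive.

Import Order.TTheory GRing.Theory Num.Theory.
Import numFieldNormedType.Exports.

Local Open Scope classical_set_scope.
Local Open Scope ring_scope.

(** * Euclidean inner product and the matrix 2-norm *)

Section Dot.
Context {R : realType}.
Implicit Type n : nat.

Lemma dotC n (u v : 'cV[R]_n) : dot u v = dot v u.
Proof. by apply: eq_bigr => i _; rewrite mulrC. Qed.

Lemma dotDl n (u v w : 'cV[R]_n) : dot (u + v) w = dot u w + dot v w.
Proof.
by rewrite -big_split; apply: eq_bigr => i _; rewrite mxE mulrDl.
Qed.

Lemma dotZl n (c : R) (u v : 'cV[R]_n) : dot (c *: u) v = c * dot u v.
Proof. by rewrite mulr_sumr; apply: eq_bigr => i _; rewrite mxE mulrA. Qed.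

Lemma dotNl n (u v : 'cV[R]_n) : dot (- u) v = - dot u v.
Proof. by rewrite -scaleN1r dotZl mulN1r. Qed.

Lemma dotDr n (u v w : 'cV[R]_n) : dot w (u + v) = dot w u + dot w v.
Proof. by rewrite dotC dotDl !(dotC w). Qed.

Lemma dotNr n (u v : 'cV[R]_n) : dot u (- v) = - dot u v.
Proof. by rewrite dotC dotNl dotC. Qed.

Lemma dotZr n (c : R) (u v : 'cV[R]_n) : dot u (c *: v) = c * dot u v.
Proof. by rewrite dotC dotZl dotC. Qed.

Lemma dot0l n (u : 'cV[R]_n) : dot 0 u = 0.
Proof. by rewrite -(scale0r 0) dotZl mul0r. Qed.

Lemma dot0r n (u : 'cV[R]_n) : dot u 0 = 0.
Proof. by rewrite dotC dot0l. Qed.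

Definition dotE := (dotDl, dotDr, dotNl, dotNr, dotZl, dotZr).

Lemma dot_ge0 n (u : 'cV[R]_n) : 0 <= dot u u.
Proof. by apply: sumr_ge0 => i _; exact: sqr_ge0. Qed.

Lemma coord_sqr_le_dot n (u : 'cV[R]_n) i : u i 0 ^+ 2 <= dot u u.
Proof.
rewrite /dot (bigD1 i) //= -expr2 lerDl.
by apply: sumr_ge0 => j _; exact: sqr_ge0.
Qed.

Lemma dot_eq0 n (u : 'cV[R]_n) : dot u u = 0 -> u = 0.
Proof.
move=> u0; apply/colP => i; rewrite mxE; apply/eqP.
by rewrite -sqrf_eq0 eq_le sqr_ge0 andbT -u0 coord_sqr_le_dot.
Qed.

Lemma dot_gt0 n (u : 'cV[R]_n) : u != 0 -> 0 < dot u u.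
Proof.
move=> u0; rewrite lt_neqAle dot_ge0 andbT eq_sym.
by apply: contra_neq u0; exact: dot_eq0.
Qed.

Lemma dotM m n (M : 'M[R]_(m, n)) u v : dot u (M *m v) = dot (M^T *m u) v.
Proof.
rewrite /dot; under eq_bigr do rewrite mxE mulr_sumr.
rewrite exchange_big; apply: eq_bigr => j _; rewrite mxE mulr_suml.
by apply: eq_bigr => i _; rewrite mxE; ring.
Qed.

(** Expanding the square of [dot v v *: u - dot u v *: v] gives [dot v v] times the gap between the
    two sides. *)
Lemma cauchy_schwarz n (u v : 'cV[R]_n) : dot u v ^+ 2 <= dot u u * dot v v.
Proof.
have [->|v0] := eqVneq v 0; first by rewrite !dot0r expr0n mulr0.
have vv := dot_gt0 v0.
have := dot_ge0 (dot v v *: u - dot u v *: v).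
rewrite !dotE (dotC v u) => h.
rewrite -subr_ge0 -(pmulr_rge0 _ vv).
suff -> : dot v v * (dot u u * dot v v - dot u v ^+ 2) =
  dot v v * (dot v v * dot u u) + - (dot u v * (dot v v * dot u v)) +
  (- (dot v v * (dot u v * dot u v)) + - - (dot u v * (dot u v * dot v v))).
  by move: h; lra.
by ring.
Qed.

Lemma enorm_sqr n (u : 'cV[R]_n) : enorm u ^+ 2 = dot u u.
Proof. by rewrite sqr_sqrtr ?dot_ge0. Qed.

Lemma enormZ n (c : R) (u : 'cV[R]_n) : enorm (c *: u) = `|c| * enorm u.
Proof.
by rewrite /enorm !dotE mulrA -expr2 sqrtrM ?sqr_ge0 // sqrtr_sqr.
Qed.

Lemma enorm_gt0 n (u : 'cV[R]_n) : u != 0 -> 0 < enorm u.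
Proof. by move=> u0; rewrite sqrtr_gt0 dot_gt0. Qed.

(** Cauchy-Schwarz row by row; the constant is the squared Frobenius norm. It shows that the set
    defining [norm2] is bounded, so that its supremum is meaningful. *)
Lemma dot_mulmx_le m n (M : 'M[R]_(m, n)) (x : 'cV[R]_n) :
  dot (M *m x) (M *m x) <= (\sum_i dot (row i M)^T (row i M)^T) * dot x x.
Proof.
rewrite /dot mulr_suml; apply: ler_sum => i _.
rewrite -expr2 -/(dot x x) -/(dot (row i M)^T (row i M)^T).
apply: le_trans (cauchy_schwarz _ _).
by rewrite mxE /dot; under [in leRHS]eq_bigr do rewrite !mxE.
Qed.

Lemma norm2_ge m n (M : 'M[R]_(m, n)) (x : 'cV[R]_n) :
  enorm (M *m x) <= norm2 M * enorm x.
Proof.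
have [->|x0] := eqVneq x 0.
  by rewrite mulmx0 /enorm !dot0l sqrtr0 mulr0.
have nx := enorm_gt0 x0.
rewrite -ler_pdivrMr //.
have -> : enorm (M *m x) / enorm x = enorm (M *m ((enorm x)^-1 *: x)).
  by rewrite -scalemxAr enormZ ger0_norm ?invr_ge0 ?sqrtr_ge0 // mulrC.
apply: sup_upper_bound.
  split; first by exists (enorm (M *m 0)), 0 => //=; rewrite /enorm dot0l sqrtr0.
  exists (Num.sqrt (\sum_i dot (row i M)^T (row i M)^T)) => _ [v /= v1 <-].
  rewrite /enorm ler_sqrt; last by apply: sumr_ge0 => i _; exact: dot_ge0.
  apply: le_trans (dot_mulmx_le _ _) _.
  rewrite ler_piMr //; first by apply: sumr_ge0 => i _; exact: dot_ge0.
  by rewrite -enorm_sqr expr_le1 ?sqrtr_ge0.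
exists ((enorm x)^-1 *: x) => //=.
by rewrite enormZ ger0_norm ?invr_ge0 ?sqrtr_ge0 // mulVf // gt_eqF.
Qed.

Lemma norm2_gt0 m n (M : 'M[R]_(m, n)) : M != 0 -> 0 < norm2 M.
Proof.
move=> M0; have [j cj] : exists j, col j M != 0.
  apply/existsP; apply: contra_neqT M0 => /existsPn h.
  by apply/matrixP => i j; move/negPn/eqP/colP/(_ i): (h j); rewrite !mxE.
have := norm2_ge M (delta_mx j 0); rewrite -colE => h.
have e0 : 0 < enorm (col j M) by exact: enorm_gt0.
rewrite ltNge; apply/negP => M0'.
by have := lt_le_trans e0 h; rewrite ltNge mulr_le0_ge0 // sqrtr_ge0.
Qed.

Lemma dot_norm2_le m n (M : 'M[R]_(m, n)) (x : 'cV[R]_n) :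
  dot (M *m x) (M *m x) <= norm2 M ^+ 2 * dot x x.
Proof.
rewrite -!enorm_sqr -exprMn lerXn2r ?nnegrE ?sqrtr_ge0 ?norm2_ge //.
exact: le_trans (sqrtr_ge0 _) (norm2_ge _ _).
Qed.

End Dot.

(** * Limits of vectors and extraction of subsequences *)

Section Convergence.
Context {R : realType}.
Implicit Type n : nat.

Lemma cvg_colP {T : Type} {F : set_system T} {FF : Filter F} n
    (u : T -> 'cV[R]_n) (l : 'cV[R]_n) :
  u @ F --> l <-> forall i, u k i 0 @[k --> F] --> l i 0.
Proof.
split=> [ul i|ul].
  exact: (cvg_comp _ _ ul (@coord_continuous _ _ _ i 0 l)).
apply/cvg_ballP => e e0.
apply: filterS (filter_forall _ (fun i => cvg_ball (ul i) e0)) => k h.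
by split=> // i j; rewrite (ord1 j); exact: h.
Qed.

Lemma cvg_dot {T : Type} {F : set_system T} {FF : Filter F} n
    (u v : T -> 'cV[R]_n) (a b : 'cV[R]_n) :
  u @ F --> a -> v @ F --> b -> dot (u k) (v k) @[k --> F] --> dot a b.
Proof.
move=> /cvg_colP ua /cvg_colP vb.
rewrite /dot; apply: cvg_big => [|i _]; [exact: add_continuous|exact: cvgM].
Qed.

Lemma cvg_mulmx m n (M : 'M[R]_(m, n)) (u : nat -> 'cV[R]_n) (a : 'cV[R]_n) :
  u @ \oo --> a -> M *m u k @[k --> \oo] --> M *m a.
Proof.
move=> ua; apply/cvg_colP => i.
have rowE x : (M *m x) i 0 = dot (row i M)^T x.
  by rewrite mxE; apply: eq_bigr => j _; rewrite !mxE.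
rewrite rowE; under eq_fun do rewrite rowE.
by apply: cvg_dot ua; exact: cvg_cst.
Qed.

Lemma cvg_dot_sub0 n (u : nat -> 'cV[R]_n) (a : 'cV[R]_n) :
  dot (u k - a) (u k - a) @[k --> \oo] --> 0 -> u @ \oo --> a.
Proof.
move=> h; apply/cvg_colP => i.
apply/cvgrPdist_lt => e e0.
move/cvgrPdist_lt: h => /(_ (e ^+ 2)); rewrite exprn_gt0 // => /(_ isT).
apply: filterS => k; rewrite sub0r normrN ger0_norm ?dot_ge0 // => h.
rewrite -(ltr_pXn2r (n := 2)) ?nnegrE ?normr_ge0 ?(ltW e0) //.
apply: le_lt_trans h; rewrite real_normK ?num_real //.
by apply: le_trans (coord_sqr_le_dot _ i); rewrite !mxE -sqrrN opprB.
Qed.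

Lemma increasing_seq_cvg (phi : nat -> nat) :
  increasing_seq phi -> phi @ \oo --> \oo.
Proof.
move=> phi_inc; have ge_id k : (k <= phi k)%N.
  elim: k => // k ih; apply: leq_ltn_trans ih _.
  by rewrite ltnNge -leEnat phi_inc ltnn.
by apply/cvgnyPge => A; exists A => // k /= Ak; exact: leq_trans (ge_id k).
Qed.

(** Bolzano-Weierstrass is applied to one coordinate after the other; each further extraction
    preserves the limits already obtained. *)
Lemma bounded_cvg_subseq n (u : nat -> 'cV[R]_n) (B : R) :
  (forall k, dot (u k) (u k) <= B) ->
  exists phi (a : 'cV[R]_n),
    phi @ \oo --> \oo /\ u (phi k) @[k --> \oo] --> a.
Proof.
move=> uB.
have [phi [phioo ucvg]] : exists phi : nat -> nat, phi @ \oo --> \oo /\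
    forall i, i \in enum 'I_n -> cvgn (fun k => u (phi k) i 0).
  elim: (enum 'I_n) => [|i s [phi [phioo ih]]].
    by exists id; split=> //; exact: cvg_id.
  have [|f f_inc f_cvg] := bolzano_weierstrass (u_ := fun k => u (phi k) i 0).
    exists (1 + B); split; first exact: num_real.
    move=> x Bx k _; apply: le_trans (ltW Bx).
    have := coord_sqr_le_dot (u (phi k)) i; have := uB (phi k).
    have := sqr_ge0 (`|u (phi k) i 0| - 1).
    rewrite -(@real_normK _ (u (phi k) i 0)) ?num_real //=.
    by move=> *; nra.
  exists (phi \o f); split.
    exact: (cvg_comp _ _ (increasing_seq_cvg f_inc) phioo).
  move=> j; rewrite inE => /orP[/eqP->//|js].
  apply/cvg_ex; exists (limn (fun k => u (phi k) j 0)).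
  exact: (cvg_comp _ _ (increasing_seq_cvg f_inc) (ih _ js)).
exists phi, (\col_i limn (fun k => u (phi k) i 0)); split=> //.
by apply/cvg_colP => i; rewrite mxE; apply: ucvg; rewrite mem_enum.
Qed.

End Convergence.

(** * Subgradients with a quadratic term *)

Section StrongSubgradient.
Context {R : realType}.
Implicit Types (n : nat) (rho : R).

(** Common form for the convex subgradients of [f] and the Fréchet subgradients of [g]. The modulus
    [rho] may be negative, which covers weakly convex functions. *)
Definition strong_subdiff n rho (h : 'cV[R]_n -> \bar R) (z : 'cV[R]_n) :
    set 'cV[R]_n :=
  [set u | dom h z /\ forall w,
    (h z + (dot u (w - z) + rho / 2 * dot (w - z) (w - z))%:E <= h w)%E].

Lemma dom_fin n (h : 'cV[R]_n -> \bar R) z :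
  proper_fun h -> dom h z -> exists a, h z = a%:E.
Proof.
rewrite /dom /= => -[/(_ z) + _]; case: (h z) => [a _ _|//|//].
by exists a.
Qed.

Lemma alpha_convex_segment n rho (h : 'cV[R]_n -> \bar R) z w (a b t : R) :
  alpha_convex rho h -> h z = a%:E -> h w = b%:E -> 0 < t < 1 ->
  (h (z + t *: (w - z))%R <=
   ((1 - t) * a + t * b - rho / 2 * (t * (1 - t)) * dot (w - z) (w - z))%:E)%E.
Proof.
move=> hc ha hb t01; have := hc w z t t01.
have -> : t *: w + (1 - t) *: z = z + t *: (w - z).
  by rewrite scalerBl scale1r scalerBr addrCA addrA addrAC -addrA addrC.
rewrite ha hb !enorm_sqr -!EFinB -!EFinM -EFinD leeBlDr // -EFinD.
move=> /le_trans; apply; rewrite lee_fin !dotE (dotC w z).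
by rewrite le_eqVlt; apply/orP; left; apply/eqP; ring.
Qed.

(** Convexity bounds [h] from above on the segment from [z] to [w]. Comparing this with the local
    lower bound, dividing by [t] and letting [t] become small turns a local inequality into a global
    one. *)
Lemma strong_subdiff_local n rho (h : 'cV[R]_n -> \bar R) z u :
  proper_fun h -> alpha_convex rho h -> dom h z ->
  (forall w e, 0 < e -> exists t, [/\ 0 < t < 1, t <= e &
    (h z + (t * (dot u (w - z) - e))%:E <= h (z + t *: (w - z))%R)%E]) ->
  strong_subdiff rho h z u.
Proof.
move=> hp hc hz loc; split=> // w.
have [hw|] := boolP (h w < +oo)%E; last first.
  by rewrite ltey negbK => /eqP ->; rewrite leey.
have [a ha] := dom_fin hp hz; have [b hb] := dom_fin hp hw.
rewrite ha hb -EFinD lee_fin.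
set d := dot (w - z) (w - z).
(* The local slack is [e / K] with [K] this constant: the slack and the leftover term
   [rho / 2 * t * d], where [t <= e / K], then add up to at most [e]. *)
have K0 : 0 < 1 + `|rho| / 2 * d.
  by rewrite ltr_pwDl // mulr_ge0 ?dot_ge0 // divr_ge0.
rewrite -lerBrDl; apply/ler_addgt0Pr => e e0.
have [t [t01 te ineq]] := loc w _ (divr_gt0 e0 K0).
have := le_trans ineq (alpha_convex_segment hc ha hb t01).
rewrite ha -EFinD lee_fin -/d => {}ineq.
have [t0 t1] := andP t01.
have : t * (dot u (w - z) - e / (1 + `|rho| / 2 * d)) <=
       t * (b - a - rho / 2 * (1 - t) * d) by move: ineq; lra.
rewrite ler_pM2l // => {}ineq.
have : rho / 2 * t * d <= `|rho| / 2 * d * (e / (1 + `|rho| / 2 * d)).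
  apply: (@le_trans _ _ (`|rho| / 2 * t * d)).
    have td0 : 0 <= t * d by rewrite mulr_ge0 ?dot_ge0 // ltW.
    by have := ler_wpM2r td0 (ler_norm rho); lra.
  rewrite mulrAC ler_wpM2l // mulr_ge0 ?dot_ge0 // divr_ge0 //.
suff -> : `|rho| / 2 * d * (e / (1 + `|rho| / 2 * d)) =
  e - e / (1 + `|rho| / 2 * d) by move: ineq; lra.
move: K0; set K := 1 + _ => K0; rewrite (_ : `|rho| / 2 * d = K - 1); last first.
  by rewrite /K addrAC subrr add0r.
by field; rewrite gt_eqF.
Qed.

Lemma strong_subdiff_subdiff n rho (h : 'cV[R]_n -> \bar R) z u :
  proper_fun h -> alpha_convex rho h -> subdiff h z u ->
  strong_subdiff rho h z u.
Proof.
move=> hp hc [hz hu]; apply: strong_subdiff_local => // w e e0.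
exists (Num.min e (1 / 2)); rewrite ge_min lexx lt_min e0 /=; split=> //.
  by rewrite gt_min; apply/andP; split; [lra|apply/orP; right; lra].
set t := Num.min _ _; have t0 : 0 < t by rewrite lt_min e0; lra.
apply: le_trans (hu _); rewrite addeC leeD2r // lee_fin.
by rewrite addrAC subrr add0r dotZl (dotC _ u) ler_pM2l // gerBl ltW.
Qed.

Lemma subdiff_strong_subdiff n rho (h : 'cV[R]_n -> \bar R) z u :
  0 <= rho -> strong_subdiff rho h z u -> subdiff h z u.
Proof.
move=> rho0 [hz hu]; split=> // w; apply: le_trans (hu w).
rewrite addeC leeD2l // lee_fin dotC lerDl.
by rewrite mulr_ge0 ?dot_ge0 // divr_ge0.
Qed.

(** Fermat's rule for a sum. Differentiability of [q] is replaced by a quadratic upper expansion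
    around [z] in which [- u] plays the gradient. *)
Lemma strong_subdiff_minimizer n rho (h : 'cV[R]_n -> \bar R)
    (q c : 'cV[R]_n -> R) z u :
  proper_fun h -> alpha_convex rho h ->
  minimizer (fun w => h w + (q w)%:E)%E z ->
  (forall d t, 0 < t -> q (z + t *: d) <= q z - t * dot u d + c d * t ^+ 2) ->
  strong_subdiff rho h z u.
Proof.
move=> hp hc zmin qle.
have hz : dom h z.
  have [_ [v hv]] := hp; have [b hb] := dom_fin hp hv.
  have := zmin v; rewrite hb /dom /=.
  by case: (h z) => [r _| |_]; rewrite ?ltry ?ltNyr // addye // leye_eq.
apply: strong_subdiff_local => // w e e0.
set d := w - z; have c0 : 0 < 1 + `|c d| by rewrite ltr_pwDl.
(* The last entry makes the second-order error [c d * t ^+ 2] at most [t * e]. *)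
pose t := Num.min e (Num.min (1 / 2) (e / (1 + `|c d|))).
have t0 : 0 < t by rewrite !lt_min e0 (divr_gt0 e0 c0) andbT /=; lra.
have t1 : t <= 1 / 2 by rewrite !ge_min lexx orbT.
have tc : t * (1 + `|c d|) <= e by rewrite -ler_pdivlMr // !ge_min lexx !orbT.
exists t; split; [by rewrite t0 /=; lra | by rewrite ge_min lexx |].
have [a ha] := dom_fin hp hz.
have := zmin (z + t *: d); rewrite ha.
case: (h (z + t *: d)) => [b| |]; rewrite ?leey // -!EFinD !lee_fin.
have := qle d t t0; have := ler_norm (c d); nra.
Qed.

End StrongSubgradient.

(** * Fréchet subgradients, closedness of the graph and existence of minimizers *)

Section ClosedSubgradients.
Context {R : realType}.
Implicit Types (n : nat) (rho : R).

(** The lower limit bounds the difference quotient on a punctured neighbourhood of [z], which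
    contains [z + t *: (w - z)] for small [t > 0]; this is the input of [strong_subdiff_local]. *)
Lemma frechet_strong_subdiff n rho (h : 'cV[R]_n -> \bar R) z u :
  proper_fun h -> alpha_convex rho h -> frechet_subdiff h z u ->
  strong_subdiff rho h z u.
Proof.
move=> hp hc [hz]; rewrite limf_einfE => hu.
apply: strong_subdiff_local => // w e e0.
have [a ha] := dom_fin hp hz.
(* The punctured neighbourhood says nothing here, but the inequality reduces to [- (t * e) <= 0]. *)
have [->|wz] := eqVneq w z.
  exists (Num.min e (1 / 2)); rewrite ge_min lexx lt_min e0 /=; split=> //.
    by rewrite gt_min; apply/andP; split; [lra|apply/orP; right; lra].
  rewrite subrr scaler0 addr0 dot0r sub0r ha -EFinD lee_fin gerDl.
  by rewrite mulr_ge0_le0 ?oppr_le0 ?ltW // lt_min e0; lra.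
have d0 : w - z != 0 by rewrite subr_eq0.
set d := w - z in d0 *; have nd := enorm_gt0 d0.
(* The threshold is divided by [enorm d] so that multiplication by [t * enorm d] leaves the error
   [t * e]. *)
have [_ [V zV <-] infV] : exists2 r, [set ereal_inf [set
    ((h v - h z - (dot u (v - z))%:E) * ((enorm (v - z))^-1)%:E)%E | v in V]
    | V in z^'] r & ((- (e / enorm d))%:E < r)%E.
  by apply: ereal_sup_gt; apply: lt_le_trans hu; rewrite lte_fin oppr_lt0 divr_gt0.
have to_z : z + t *: d @[t --> 0^'+] --> z.
  apply: cvg_at_right_filter; rewrite -[X in _ --> X]addr0 -(scale0r d).
  by apply: cvgD; [exact: cvg_cst|apply: cvgZr_tmp; exact: cvg_id].
have : \forall t \near (0 : R)^'+,
    [/\ 0 < t, t < Num.min e 1 & z + t *: d != z -> V (z + t *: d)].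
  near=> t; split; last by near: t; exact: (to_z [set v | v != z -> V v] zV).
  - by near: t; exact: nbhs_right_gt.
  - by near: t; apply: nbhs_right_lt; rewrite lt_min e0 ltr01.
move=> /filter_ex[t [t0 + tV]]; rewrite lt_min => /andP[te t1].
exists t; split; [by rewrite t0|exact: ltW|].
have {}tV : V (z + t *: d).
  by apply: tV; rewrite -subr_eq0 addrAC subrr add0r scaler_eq0 gt_eqF.
have := lt_le_trans infV (ereal_inf_lbound (imageP _ tV)).
rewrite /= ha [z + _ - z]addrAC subrr add0r enormZ gtr0_norm // dotZr.
have := hp.1 (z + t *: d); case: (h (z + t *: d)) => [b _|_ _|//];
  last by rewrite leey.
rewrite -!EFinB -EFinM lte_fin -EFinD lee_fin => ineq.
have td0 : 0 < t * enorm d by rewrite mulr_gt0.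
move: ineq; rewrite ltr_pdivlMr // mulNr (mulrC t (enorm d)) mulrA divfK ?gt_eqF //.
lra.
Unshelve. all: by end_near. Qed.

(** The difference quotient at [v] is at least [rho / 2 * enorm (v - z)], which stays above [- e] on
    the ball of radius [r]. *)
Lemma strong_subdiff_frechet n rho (h : 'cV[R]_n -> \bar R) z u :
  proper_fun h -> strong_subdiff rho h z u -> frechet_subdiff h z u.
Proof.
move=> hp [hz hu]; split=> //; rewrite limf_einfE.
have [a ha] := dom_fin hp hz.
apply/lee_addgt0Pr => e e0; rewrite -leeBlDr // sub0e.
have K0 : 0 < 1 + `|rho| / 2 by rewrite ltr_pwDl // divr_ge0.
pose r := e / (1 + `|rho| / 2).
have r0 : 0 < r by rewrite divr_gt0.
apply: le_ereal_sup_tmp; exists (ereal_inf [set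
    ((h v - h z - (dot u (v - z))%:E) * ((enorm (v - z))^-1)%:E)%E | v in
    [set v | v != z /\ enorm (v - z) < r]]).
  exists [set v | v != z /\ enorm (v - z) < r] => //.
  have sub0 : dot (v - z) (v - z) @[v --> z] --> dot (0 : 'cV[R]_n) 0.
    have sub0 : v - z @[v --> z] --> z - z by exact: (cvgB (@cvg_id _ _) (cvg_cst z)).
    by rewrite subrr in sub0; exact: (cvg_dot sub0 sub0).
  have : \forall v \near z, dot (v - z) (v - z) < r ^+ 2.
    by apply: (cvgr_lt _ sub0); rewrite dot0l exprn_gt0.
  apply: filterS => v vr vz; split=> //.
  by rewrite -(ltr_pXn2r (n := 2)) ?nnegrE ?sqrtr_ge0 ?ltW // enorm_sqr.
apply: le_ereal_inf_tmp => _ [v [vz vr] <-].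
have nv : 0 < enorm (v - z) by rewrite enorm_gt0 // subr_eq0.
have := hu v; rewrite ha lee_pdivlMr // -EFinN -EFinM.
case: (h v) => [b| |]; rewrite ?leey // -!EFinD !lee_fin -enorm_sqr => ineq.
set N := enorm (v - z) in nv vr ineq *.
have : (1 + `|rho| / 2) * N <= e by rewrite mulrC -ler_pdivlMr // ltW.
have := ler_norm (- rho); rewrite normrN => rhoN eN.
have : `|rho| / 2 * N <= e by nra.
by nra.
Qed.

Lemma lsc_cvg n (h : 'cV[R]_n -> \bar R) (s : nat -> 'cV[R]_n) z r :
  lower_semicontinuous h -> s @ \oo --> z -> (r%:E < h z)%E ->
  \forall k \near \oo, (r%:E < h (s k))%E.
Proof.
move=> hlsc sz /hlsc[V zV hV].
by have : \forall k \near \oo, V (s k); [exact: sz|apply: filterS => k /hV].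
Qed.

(** Lets lower semicontinuity act through real minorants [r], before the value [x] is known to be
    finite. *)
Lemma lee_of_lt (x : \bar R) (b : R) :
  (forall r, (r%:E < x)%E -> r <= b) -> (x <= b%:E)%E.
Proof.
case: x => [a| |] h; rewrite ?leNye // ?leye_eq /=.
- rewrite lee_fin; apply/ler_addgt0Pr => e e0.
  by rewrite -lerBlDr; apply: h; rewrite lte_fin ltrBlDr ltrDl.
- by have := h (b + 1); rewrite ltry => /(_ isT); rewrite gerDl ler10.
Qed.

(** Lower semicontinuity passes the subgradient inequality at [s k], tested at a fixed [w], to the
    limit. Testing at a point of the domain also shows that [h z] is finite. *)
Lemma strong_subdiff_closed n rho (h : 'cV[R]_n -> \bar R)
    (s v : nat -> 'cV[R]_n) z u :
  proper_fun h -> lower_semicontinuous h ->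
  s @ \oo --> z -> v @ \oo --> u ->
  (\forall k \near \oo, strong_subdiff rho h (s k) (v k)) ->
  strong_subdiff rho h z u.
Proof.
move=> hp hlsc sz vu sv.
have key w b : h w = b%:E ->
    (h z <= (b - (dot u (w - z) + rho / 2 * dot (w - z) (w - z)))%:E)%E.
  move=> hb; apply: lee_of_lt => r /(lsc_cvg hlsc sz) sr; rewrite lerBrDr.
  have ws : w - s k @[k --> \oo] --> w - z by apply: cvgB => //; exact: cvg_cst.
  have lim : r + (dot (v k) (w - s k) + rho / 2 * dot (w - s k) (w - s k))
      @[k --> \oo] --> r + (dot u (w - z) + rho / 2 * dot (w - z) (w - z)).
    apply: cvgD; first exact: cvg_cst.
    apply: cvgD; first exact: cvg_dot.
    by apply: cvgM; [exact: cvg_cst|exact: cvg_dot].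
  apply: (cvgr_to_le lim); near=> k.
  have [_ /(_ w)] : strong_subdiff rho h (s k) (v k) by near: k.
  rewrite hb -lee_fin; apply: le_trans; rewrite EFinD leeD2r // ltW //.
  by near: k.
have hz : dom h z.
  have [_ [w hw]] := hp; have [b hb] := dom_fin hp hw.
  exact: le_lt_trans (key _ _ hb) (ltry _).
split=> // w.
have [hw|] := boolP (h w < +oo)%E; last first.
  by rewrite ltey negbK => /eqP ->; rewrite leey.
have [b hb] := dom_fin hp hw; have [a ha] := dom_fin hp hz.
by have := key _ _ hb; rewrite ha hb -EFinD !lee_fin lerBrDr.
Unshelve. all: by end_near. Qed.

(** Direct method: coercivity bounds a minimizing sequence, and lower semicontinuity makes its
    cluster points minimizers. *)
Lemma coercive_minimizer n (h : 'cV[R]_n -> \bar R) (q : 'cV[R]_n -> R)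
    (c B : R) :
  proper_fun h -> lower_semicontinuous h ->
  (forall (s : nat -> 'cV[R]_n) z,
    s @ \oo --> z -> q (s k) @[k --> \oo] --> q z) ->
  0 < c -> (forall w, ((c * dot w w - B)%:E <= h w + (q w)%:E)%E) ->
  exists z, minimizer (fun w => h w + (q w)%:E)%E z.
Proof.
move=> hp hlsc q_cont c0 coer.
pose S := range (fun w => h w + (q w)%:E)%E.
have [mu muE] : exists mu, ereal_inf S = mu%:E.
  have [_ [v hv]] := hp; have [b hb] := dom_fin hp hv.
  have : (ereal_inf S <= (b + q v)%:E)%E.
    by apply: ereal_inf_lbound; exists v => //; rewrite hb.
  have : ((- B)%:E <= ereal_inf S)%E.
    apply: le_ereal_inf_tmp => _ [w _ <-]; apply: le_trans (coer w).
    by rewrite lee_fin lerDr mulr_ge0 ?dot_ge0 // ltW.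
  by case: (ereal_inf S) => [mu _ _|//|//]; exists mu.
have approx k : exists w, (h w + (q w)%:E <= (mu + harmonic k)%:E)%E.
  have [_ [w _ <-] /ltW wk] : exists2 y, S y & (y < (mu + harmonic k)%:E)%E.
    by apply: ereal_inf_lt; rewrite muE lte_fin ltrDl harmonic_gt0.
  by exists w.
have [s sP] := choice approx.
have [|phi [z [phioo sz]]] := @bounded_cvg_subseq _ _ s ((mu + 1 + B) / c).
  move=> k; rewrite ler_pdivlMr // mulrC.
  have : harmonic k <= 1 :> R by rewrite /harmonic invf_le1 ?ler1n ?ltr0n.
  by have := le_trans (coer (s k)) (sP k); rewrite lee_fin; lra.
exists z => w; apply: (@le_trans _ _ (ereal_inf S)); last first.
  by apply: ereal_inf_lbound; exists w.
rewrite muE -leeBrDr //; apply: lee_of_lt => r /(lsc_cvg hlsc sz) rs.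
rewrite lerBrDr.
have harm0 : harmonic (phi k) @[k --> \oo] --> (0 : R).
  exact: (cvg_comp _ _ phioo cvg_harmonic).
have lim : r + q (s (phi k)) - harmonic (phi k) @[k --> \oo] --> r + q z - 0.
  by apply: cvgB => //; apply: cvgD; [exact: cvg_cst|exact: q_cont].
rewrite -[r + _]subr0; apply: (cvgr_to_le lim); near=> k.
rewrite lerBlDr -lee_fin; apply: le_trans (sP (phi k)).
by rewrite EFinD leeD2r // ltW //; near: k.
Unshelve. all: by end_near. Qed.

End ClosedSubgradients.

(** * Monotonicity and bounds drawn from the relative interior condition *)

Section RangeCondition.
Context {R : realType}.
Implicit Types (m n : nat) (rho : R).

(** Sum of the two subgradient inequalities, each tested at the other point. *)
Lemma strong_subdiff_monotone n rho (h : 'cV[R]_n -> \bar R) z z' u u' :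
  proper_fun h -> strong_subdiff rho h z u -> strong_subdiff rho h z' u' ->
  rho * dot (z - z') (z - z') <= dot (u - u') (z - z').
Proof.
move=> hp [hz hu] [hz' hu'].
have [a ha] := dom_fin hp hz; have [b hb] := dom_fin hp hz'.
have := hu z'; have := hu' z; rewrite ha hb -!EFinD !lee_fin.
by rewrite -(opprB z z') !dotE; lra.
Qed.

Lemma affine_hull0_scale n (C : set 'cV[R]_n) w t :
  C 0 -> affine_hull C w -> affine_hull C (t *: w).
Proof.
move=> C0 Cw A affA CA.
by have := affA w 0 t (Cw _ affA CA) (CA _ C0); rewrite scaler0 addr0.
Qed.

(** Among the matrices with rows in [S], one of maximal rank works: appending any further element of
    [S] cannot raise the rank. *)
Lemma spanning_rows n (S : set 'cV[R]_n) :
  exists k (A : 'M[R]_(k, n)),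
    (forall i, S (row i A)^T) /\ forall w, S w -> (w^T <= A)%MS.
Proof.
pose P (r : nat) := `[< exists k (A : 'M[R]_(k, n)),
  (forall i, S (row i A)^T) /\ \rank A = r >].
have P0 : exists r, P r.
  by exists 0%N; apply/asboolP; exists 0%N, 0; split; [case|exact: mxrank0].
have Pn r : P r -> (r <= n)%N.
  by move=> /asboolP[k [A [_ <-]]]; exact: rank_leq_col.
case: (ex_maxnP P0 Pn) => r /asboolP[k [A [AS Ar]]] rmax.
exists k, A; split=> // w Sw.
have subA : (A <= col_mx A w^T)%MS by rewrite -addsmxE addsmxSl.
apply: submx_trans (_ : col_mx A w^T <= A)%MS; first by rewrite -addsmxE addsmxSr.
rewrite -(mxrank_leqif_sup subA) eqn_leq mxrankS //= Ar; apply: rmax.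
apply/asboolP; exists (k + 1)%N, (col_mx A w^T); split=> // i.
case: (split_ordP i) => j ->.
  by rewrite rowKu; exact: AS.
by rewrite rowKd row_id trmxK.
Qed.

(** A matrix is injective on its row space. Quantitatively, [w = A^T *m (P *m w)] there, so
    [dot w w = dot (A *m w) (P *m w)] and Cauchy-Schwarz applies. *)
Lemma dot_le_row_space k n (A : 'M[R]_(k, n)) :
  exists2 K, 0 <= K & forall w, (w^T <= A)%MS ->
    dot w w <= K * dot (A *m w) (A *m w).
Proof.
pose P := (pinvmx A)^T.
exists (\sum_i dot (row i P)^T (row i P)^T).
  by apply: sumr_ge0 => i _; exact: dot_ge0.
set K := \sum_i _ => w wA.
have wE : w = A^T *m (P *m w).
  by apply: trmx_inj; rewrite !trmx_mul !trmxK mulmxKpV.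
have [->|w0] := eqVneq w 0; first by rewrite mulmx0 !dot0l mulr0.
rewrite -(ler_pM2r (dot_gt0 w0)).
have := cauchy_schwarz (A *m w) (P *m w).
have -> : dot (A *m w) (P *m w) = dot w w.
  by rewrite dotC dotM -wE.
rewrite expr2 => /le_trans; apply; rewrite mulrC mulrAC.
by rewrite ler_wpM2r ?dot_ge0 //; exact: dot_mulmx_le.
Qed.

Lemma fenchel_bound n (f : 'cV[R]_n -> \bar R) v :
  proper_fun f -> dom (fenchel f) v ->
  exists F, forall w b, f w = b%:E -> dot v w <= F + b.
Proof.
move=> [_ [w0 fw0]] fv.
have bnd w : ((dot v w)%:E - f w <= fenchel f v)%E.
  by apply: ereal_sup_ubound; exists w.
move: fv bnd; rewrite /dom /=; case: (fenchel f v) => [F| |] // _ bnd.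
- exists F => w b fw; have := bnd w.
  by rewrite fw -EFinB lee_fin lerBlDr.
- exists 0 => w b fw; have := bnd w; rewrite fw -EFinB.
  by rewrite leeNy_eq.
Qed.

Lemma strong_subdiff_dom_fenchel n rho (f : 'cV[R]_n -> \bar R) z u :
  proper_fun f -> 0 <= rho -> strong_subdiff rho f z u -> dom (fenchel f) u.
Proof.
move=> fp rho0 [fz fu]; have [a fa] := dom_fin fp fz.
apply: (@le_lt_trans _ _ (dot u z - a)%:E); last exact: ltry.
apply: ge_ereal_sup => _ [w _ <-]; have := fu w; rewrite fa.
have [fw|] := boolP (f w < +oo)%E; last first.
  by rewrite ltey negbK => /eqP -> _; rewrite leNye.
have [b ->] := dom_fin fp fw; rewrite -EFinD -EFinB !lee_fin.
have : 0 <= rho / 2 * dot (w - z) (w - z) by rewrite mulr_ge0 ?dot_ge0 // divr_ge0.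
by rewrite (dotDr w (- z) u) dotNr; lra.
Qed.

(** Each [c] in [C] is a linear form bounded above on the [w] considered. Since 0 is a relative
    interior point, small multiples of both [a] and [- a] lie in [C] for [a] in the affine hull, so
    [dot a w] is bounded on both sides; finitely many such [a] control [w] inside the hull. *)
Lemma ri_row_bound m n (M : 'M[R]_(m, n)) (f : 'cV[R]_n -> \bar R) B1 B2 :
  proper_fun f -> ri (minkowski_sub (dom (fenchel f)) (ran M^T)) 0 ->
  exists K, forall w b, f w = b%:E -> b <= B1 -> dot (M *m w) (M *m w) <= B2 ->
    affine_hull (minkowski_sub (dom (fenchel f)) (ran M^T)) w -> dot w w <= K.
Proof.
set C := minkowski_sub _ _ => fp [C0 Cnear].
have Cbound c : C c -> exists F, forall w b,
    f w = b%:E -> b <= B1 -> dot (M *m w) (M *m w) <= B2 -> dot c w <= F.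
  move=> [v fv [_ [y _ <-] <-]]; have [F vF] := fenchel_bound fp fv.
  (* Fenchel-Young bounds the part from [v]; [0 <= dot (y + M *m w) (y + M *m w)] bounds
     [- dot y (M *m w)]. *)
  exists (F + B1 + (dot y y + B2) / 2) => w b fw bB MwB.
  have := vF w b fw; have := dot_ge0 (y + M *m w).
  have -> : dot (v - M^T *m y) w = dot v w - dot y (M *m w).
    by rewrite dotDl dotNl -dotM.
  by rewrite !dotE (dotC (M *m w) y); lra.
have [k [A [AC CA]]] := spanning_rows (affine_hull C).
have row_bound i : exists F, forall w b,
    f w = b%:E -> b <= B1 -> dot (M *m w) (M *m w) <= B2 ->
    `|dot (row i A)^T w| <= F.
  set a := (row i A)^T.
  have to0 s : t *: (s *: a) @[t --> 0^'+] --> (0 : 'cV[R]_n).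
    by apply: cvg_at_right_filter; rewrite -[X in _ --> X](scale0r (s *: a));
      apply: cvgZr_tmp; exact: cvg_id.
  have Cs s : \forall t \near 0^'+, C (t *: (s *: a)).
    have : \forall t \near 0^'+, affine_hull C (t *: (s *: a)) -> C (t *: (s *: a)).
      exact: (to0 s _ Cnear).
    by apply: filterS => t; apply; do 2 apply: affine_hull0_scale => //; exact: AC.
  have : \forall t \near 0^'+, [/\ 0 < t, C (t *: (1 *: a)) & C (t *: ((-1) *: a))].
    near=> t; split; near: t; [exact: nbhs_right_gt|exact: Cs|exact: Cs].
  move=> /filter_ex[t [t0 /Cbound[F1 CF1] /Cbound[F2 CF2]]].
  exists ((`|F1| + `|F2|) / t) => w b fw bB MwB.
  rewrite ler_pdivlMr // -[X in _ * X <= _](gtr0_norm t0) -normrM ler_norml.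
  have := CF1 w b fw bB MwB; have := CF2 w b fw bB MwB.
  rewrite !dotZl; have := ler_norm F1; have := ler_norm F2.
  have := normr_ge0 F1; have := normr_ge0 F2.
  by move=> *; apply/andP; split; lra.
have [F FP] := choice row_bound.
have [K K0 KP] := dot_le_row_space A.
exists (K * \sum_i F i ^+ 2) => w b fw bB MwB hw.
apply: le_trans (KP w (CA w hw)) _; rewrite ler_wpM2l //.
apply: ler_sum => i _; rewrite -expr2 -(real_normK (num_real _)).
rewrite lerXn2r ?nnegrE ?normr_ge0 //.
  exact: le_trans (normr_ge0 _) (FP i w b fw bB MwB).
have -> : (A *m w) i 0 = dot (row i A)^T w; last exact: FP fw bB MwB.
by rewrite mxE; apply: eq_bigr => j _; rewrite !mxE.
Unshelve. all: by end_near. Qed.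

End RangeCondition.

(** * Recovering a primal point when only the images under [M] converge *)

Section LimitPrimal.
Context {R : realType}.

(* Tikhonov regularization: the minimizer [w] of the penalized function has
   [- eps *: w] in [dom f^* - ran M^T], hence lies in the affine hull on which
   the relative interior condition bounds it uniformly in [eps]. *)
Lemma subdiff_limit_attained m n (M : 'M[R]_(m, n)) (f : 'cV[R]_n -> \bar R)
    rho (xs : nat -> 'cV[R]_n) (ps : nat -> 'cV[R]_m) (z y : 'cV[R]_m) :
  proper_fun f -> lower_semicontinuous f -> alpha_convex rho f -> 0 <= rho ->
  ri (minkowski_sub (dom (fenchel f)) (ran M^T)) 0 ->
  (forall k, strong_subdiff rho f (xs k) (- (M^T *m ps k))) ->
  M *m xs k @[k --> \oo] --> z -> ps @ \oo --> y ->
  exists x, strong_subdiff rho f x (- (M^T *m y)) /\ M *m x = z.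
Proof.
move=> fp flsc fc rho0 fri xsP Mxs psy.
(* [Q] penalizes the distance of [M *m w] to [z], [q e] adds the Tikhonov term, and [s e w] is the
   negative gradient of [q e] at [w]. *)
pose Q w := dot y (M *m w) + 1 / 2 * dot (M *m w - z) (M *m w - z).
pose q e w := Q w + e / 2 * dot w w.
pose s e w := - (M^T *m (y + (M *m w - z)) + e *: w).
have [fp0 fsub] := xsP 0%N; set p := xs 0%N in fp0 fsub.
have [a fa] := dom_fin fp fp0.
pose v := ps 0%N - y.
(* Minorize [f] by its subgradient inequality at [p], then absorb the remaining
   [- dot v (M *m w - z)] into half of the penalty; a quarter of the squared distance is left. *)
pose c1 := a + dot (ps 0%N) (M *m p) - dot v v - dot v z.
have lower w : ((c1 + 1 / 4 * dot (M *m w - z) (M *m w - z))%:E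
    <= f w + (Q w)%:E)%E.
  have := fsub w; rewrite fa.
  case: (f w) => [b| |]; rewrite ?leey // -!EFinD !lee_fin.
  have : 0 <= rho / 2 * dot (w - p) (w - p) by rewrite mulr_ge0 ?dot_ge0 // divr_ge0.
  set r := rho / 2 * _; rewrite [dot (- _) _]dotNl -dotM mulmxBr.
  have := dot_ge0 (v - 2^-1 *: (M *m w - z)).
  rewrite /c1 /Q /v !dotE (dotC z (M *m w)) (dotC z y).
  rewrite (dotC z (ps 0%N)) (dotC y (ps 0%N)) (dotC (M *m w) (ps 0%N)).
  by rewrite (dotC (M *m w) y); lra.
have q_cvg e (r : nat -> 'cV[R]_n) w : r @ \oo --> w ->
    q e (r k) @[k --> \oo] --> q e w.
  move=> rw; have Mrw := cvg_mulmx (M := M) rw.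
  have Mz : M *m r k - z @[k --> \oo] --> M *m w - z.
    by apply: cvgB => //; exact: cvg_cst.
  apply: cvgD; last by apply: cvgM; [exact: cvg_cst|exact: cvg_dot].
  apply: cvgD; first by apply: cvg_dot; [exact: cvg_cst|].
  by apply: cvgM; [exact: cvg_cst|exact: cvg_dot].
have q_expand e w : forall d t, 0 < t -> q e (w + t *: d) <=
    q e w - t * dot (s e w) d
    + (1 / 2 * dot (M *m d) (M *m d) + e / 2 * dot d d) * t ^+ 2.
  move=> d t t0; rewrite le_eqVlt; apply/orP; left; apply/eqP.
  have -> : dot (s e w) d = - (dot (y + (M *m w - z)) (M *m d) + e * dot w d).
    by rewrite /s dotNl [dot (M^T *m _ + _) _]dotDl -dotM dotZl.
  rewrite /q /Q mulmxDr -scalemxAr (addrAC (M *m w) _ (- z)).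
  move: (M *m w - z) => D; rewrite !dotE (dotC d w) (dotC (M *m d) D).
  by field.
have minimizers k : exists w, minimizer (fun w => f w + (q (harmonic k) w)%:E)%E w.
  apply: (@coercive_minimizer _ _ _ _ (harmonic k / 2) (- c1)) => //.
  - exact: q_cvg.
  - by rewrite divr_gt0 ?harmonic_gt0.
  - move=> w; rewrite opprK /q (EFinD (Q w)) addeA.
    apply: (@le_trans _ _ ((c1 + 1 / 4 * dot (M *m w - z) (M *m w - z))%:E
      + (harmonic k / 2 * dot w w)%:E)%E); last by rewrite leeD2r.
    by rewrite -EFinD lee_fin; have := dot_ge0 (M *m w - z); lra.
have [w wmin] := choice minimizers.
have wsub k : strong_subdiff rho f (w k) (s (harmonic k) (w k)).
  exact: strong_subdiff_minimizer fp fc (wmin k) (q_expand _ _).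
(* Comparison of the minimal value with the value at [p], uniformly in [k] because
   [harmonic k <= 1]. *)
pose K := a + Q p + dot p p.
have wK k : exists2 b, f (w k) = b%:E & b + Q (w k) <= K.
  have [b fb] := dom_fin fp (wsub k).1; exists b => //.
  have := wmin k p; rewrite fa fb -!EFinD lee_fin /q /K.
  have h0 := @harmonic_gt0 R k.
  have h1 : harmonic k <= 1 :> R by rewrite /harmonic invf_le1 ?ler1n ?ltr0n.
  have := dot_ge0 p; have := dot_ge0 (w k); nra.
pose B2 := 2 * dot z z + 8 * (K - c1).
have wB2 k : dot (M *m w k) (M *m w k) <= B2.
  have [b fb bK] := wK k; have := lower (w k); rewrite fb -EFinD lee_fin.
  have := dot_ge0 (M *m w k - z - z); rewrite /B2.
  rewrite !dotE (dotC z (M *m w k)); lra.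
have wB1 k b : f (w k) = b%:E -> b <= K + (dot y y + B2) / 2.
  have [b' -> b'K] := wK k => -[<-].
  move: b'K; rewrite /Q; have := dot_ge0 (M *m w k - z); have := wB2 k.
  have := dot_ge0 (y + M *m w k).
  rewrite dotDl !dotDr (dotC (M *m w k) y); lra.
have [B wB] := ri_row_bound (K + (dot y y + B2) / 2) B2 fp fri.
have [|phi [x [phioo wx]]] := @bounded_cvg_subseq _ _ w B.
  move=> k; have [b fb _] := wK k.
  apply: (wB _ _ fb (wB1 k _ fb) (wB2 k)).
  (* The affine hull contains 0, hence is stable under this rescaling, however large the factor. *)
  have -> : w k = (- (harmonic k)^-1) *: (- harmonic k *: w k).
    by rewrite scalerA mulNr mulrN opprK mulVf ?scale1r // gt_eqF // harmonic_gt0.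
  apply: affine_hull0_scale; first exact: fri.1.
  move=> A affA; apply; exists (s (harmonic k) (w k)).
    exact: strong_subdiff_dom_fenchel fp rho0 (wsub k).
  exists (M^T *m - (y + (M *m w k - z))); first by exists (- (y + (M *m w k - z))).
  by rewrite /s mulmxN opprK opprD addrAC addNr add0r scaleNr.
have harm0 : harmonic (phi k) @[k --> \oo] --> (0 : R).
  exact: (cvg_comp _ _ phioo cvg_harmonic).
have Mwx := cvg_mulmx (M := M) wx.
have s_cvg : s (harmonic (phi k)) (w (phi k)) @[k --> \oo] -->
    - (M^T *m (y + (M *m x - z))).
  rewrite -[X in - X]addr0 -(scale0r x); apply: cvgN; apply: cvgD.
    apply: cvg_mulmx; apply: cvgD; first exact: cvg_cst.
    by apply: cvgB => //; exact: cvg_cst.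
  exact: cvgZ.
have xsub : strong_subdiff rho f x (- (M^T *m (y + (M *m x - z)))).
  by apply: (strong_subdiff_closed fp flsc wx s_cvg); near=> k.
suff Mx : M *m x = z.
  by exists x; split=> //; rewrite Mx subrr addr0 in xsub.
apply/eqP; rewrite -subr_eq0; apply/eqP/dot_eq0/eqP.
rewrite eq_le dot_ge0 andbT.
(* Monotonicity between [xs k] and [x]; in the limit the left side becomes the squared distance from
   [M *m x] to [z]. *)
have mono k : dot (ps k - y - (M *m x - z)) (M *m xs k - M *m x) <= 0.
  have := strong_subdiff_monotone fp (xsP k) xsub.
  have : 0 <= rho * dot (xs k - x) (xs k - x) by rewrite mulr_ge0 ?dot_ge0.
  move=> /le_trans h /h; rewrite -opprD dotNl oppr_ge0 -mulmxN -mulmxDr -dotM.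
  by rewrite mulmxBr opprD addrA.
have lim : dot (ps k - y - (M *m x - z)) (M *m xs k - M *m x) @[k --> \oo] -->
    dot (y - y - (M *m x - z)) (z - M *m x).
  apply: cvg_dot; last by apply: cvgB => //; exact: cvg_cst.
  by apply: cvgB; [apply: cvgB => //|]; exact: cvg_cst.
have : dot (y - y - (M *m x - z)) (z - M *m x) <= 0.
  by apply: (cvgr_to_le lim); exact: nearW.
by rewrite subrr sub0r -(opprB (M *m x) z) dotNl dotNr opprK.
Unshelve. all: by end_near. Qed.

End LimitPrimal.

(** * Fejér descent estimates *)

Section Fejer.
Context {R : realType}.
Implicit Types (n : nat).

(** The right side minus the left side is [2 * d] times the sum of the slacks in the two
    monotonicity inequalities. Here [q] and [w] are the errors of [z] and [y], while [c] and [d]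
    stand for [gamma] and [delta]. *)
Lemma fejer_step n (a b c d : R) (q w r : 'cV[R]_n) :
  0 < d ->
  b * dot q q <= dot w q ->
  a * dot (q + r) (q + r) <= - dot (w + c *: r) (q + r) ->
  2 * d * ((a + b) * dot q q + (c - d + 2 * a) * dot q r
           + (c + a - d / 2) * dot r r)
  <= dot (w + d *: q) (w + d *: q) - dot (w + d *: (q + r)) (w + d *: (q + r)).
Proof.
move=> d0; rewrite !scalerDr !dotE (dotC r q) (dotC r w) (dotC q w) => h1 h2.
rewrite -subr_ge0.
rewrite (_ : _ + - _ = 2 * d * ((dot w q - b * dot q q) +
  (- (dot w q + c * dot q r + (dot w r + c * dot r r)) -
   a * (dot q q + dot q r + (dot q r + dot r r))))); last by field.
by rewrite mulr_ge0 ?mulr_ge0 ?(ltW d0) //; lra.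
Qed.

(** Lipschitz estimate for the resolvent that recovers [z] from [y + d *: z], whose operator is
    strongly monotone with modulus [d + b]. *)
Lemma resolvent_bound n (b d : R) (q w : 'cV[R]_n) :
  0 <= d + b -> b * dot q q <= dot w q ->
  (d + b) ^+ 2 * dot q q <= dot (w + d *: q) (w + d *: q).
Proof.
move=> db0 h.
have := dot_ge0 (w + d *: q - (d + b) *: q).
have : 0 <= (d + b) * (dot w q - b * dot q q) by rewrite mulr_ge0 ?subr_ge0.
rewrite !dotE (dotC q w); nra.
Qed.

(** Completing the square in [q]. The first alternative is the degenerate form met when
    [alpha + beta * norm2 M ^+ 2 = 0]. *)
Lemma quadratic_form_bound n (A B D : R) :
  (A = 0 /\ B = 0 /\ 0 < D) \/ (0 < A /\ B ^+ 2 < 4 * A * D) ->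
  exists2 c, 0 < c & forall q r : 'cV[R]_n,
    c * dot r r <= A * dot q q + B * dot q r + D * dot r r.
Proof.
case=> [[-> [-> D0]]|[A0 BAD]].
  by exists D => // q r; rewrite !mul0r !add0r.
exists (D - B ^+ 2 / (4 * A)).
  by rewrite subr_gt0 ltr_pdivrMr ?mulr_gt0 // mulrC.
move=> q r; have := mulr_ge0 (ltW A0) (dot_ge0 (q + (B / (2 * A)) *: r)).
rewrite !dotE (dotC r q) -subr_ge0 => h; rewrite -subr_ge0.
move: h; rewrite subr0; congr (0 <= _); field.
by rewrite gt_eqF.
Qed.

Lemma nonincreasing_subseq_cvg0 (V : nat -> R) (phi : nat -> nat) :
  nonincreasing_seq V -> (forall k, 0 <= V k) ->
  V (phi k) @[k --> \oo] --> 0 -> V @ \oo --> 0.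
Proof.
move=> Vinc V0 Vphi; apply/cvgrPdist_lt => e e0.
have /filter_ex[k] : \forall k \near \oo, V (phi k) < e by exact: cvgr_lt Vphi _ e0.
move=> Vk; exists (phi k) => // j /= kj.
by rewrite sub0r normrN ger0_norm //; apply: le_lt_trans Vk; exact: Vinc.
Qed.

Lemma descent_cvg0 (V d : nat -> R) :
  (forall k, 0 <= V k) -> (forall k, 0 <= d k) ->
  (forall k, d k <= V k - V k.+1) -> d @ \oo --> 0.
Proof.
move=> V0 d0 dV.
have Vcvg : cvgn V.
  apply: nonincreasing_is_cvgn; last by exists 0 => _ [k _ <-].
  by apply/nonincreasing_seqP => k; rewrite -subr_ge0; exact: le_trans (dV k).
have Vlim : V k - V k.+1 @[k --> \oo] --> limn V - limn V.
  by apply: cvgB => //; rewrite cvg_shiftS.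
rewrite subrr in Vlim; apply: (squeeze_cvgr _ (@cvg_cst _ 0 _ _ _) Vlim).
by apply: nearW => k; rewrite d0 dV.
Qed.

End Fejer.

(** * Optimality conditions of the two steps and of the limit *)

Section ADMM.
Context {R : realType}.

Lemma x_step_subdiff m n (f : 'cV[R]_n -> \bar R) (M : 'M[R]_(m, n))
    rho gamma x (z y : 'cV[R]_m) :
  proper_fun f -> alpha_convex rho f ->
  minimizer (fun w => augL f (cst 0%E) M gamma w z y) x ->
  strong_subdiff rho f x (- (M^T *m (y + gamma *: (M *m x - z)))).
Proof.
move=> fp fc xmin.
pose q w := dot y (M *m w - z) + gamma / 2 * dot (M *m w - z) (M *m w - z).
apply: (@strong_subdiff_minimizer _ _ _ _ q
  (fun d => gamma / 2 * dot (M *m d) (M *m d))) => //.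
  by move=> w; have := xmin w; rewrite /augL /= !adde0 -!addeA -!EFinD !enorm_sqr.
move=> d t _; rewrite dotNl -dotM /q mulmxDr -scalemxAr (addrAC (M *m x) _ (- z)).
move: (M *m x - z) => D; rewrite !dotE (dotC (M *m d) D) le_eqVlt.
by apply/orP; left; apply/eqP; field.
Qed.

(** The finite constant [f x] is moved into the smooth part [q]. The subgradient obtained is exactly
    the updated multiplier. *)
Lemma z_step_subdiff m n (f : 'cV[R]_n -> \bar R) (g : 'cV[R]_m -> \bar R)
    (M : 'M[R]_(m, n)) rho delta x (z y : 'cV[R]_m) :
  proper_fun f -> dom f x -> proper_fun g -> alpha_convex rho g ->
  minimizer (fun w => augL f g M delta x w y) z ->
  strong_subdiff rho g z (y + delta *: (M *m x - z)).
Proof.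
move=> fp fx gp gc zmin; have [a fa] := dom_fin fp fx.
pose q w := a + (dot y (M *m x - w) + delta / 2 * dot (M *m x - w) (M *m x - w)).
apply: (@strong_subdiff_minimizer _ _ _ _ q (fun d => delta / 2 * dot d d)) => //.
  move=> w; have := zmin w; rewrite /augL fa !(addeC a%:E) -!addeA -!EFinD.
  by rewrite !enorm_sqr.
move=> d t _; rewrite /q opprD (addrA (M *m x)).
move: (M *m x - z) => D; rewrite !dotE (dotC d D) le_eqVlt.
by apply/orP; left; apply/eqP; field.
Qed.

(** Adding the two subgradient inequalities cancels the linear terms on feasible pairs. The
    remaining quadratic part is nonnegative since the curvature of [f], seen through [M],
    compensates that of [g]. *)
Lemma strong_subdiff_solution m n (f : 'cV[R]_n -> \bar R)
    (g : 'cV[R]_m -> \bar R) (M : 'M[R]_(m, n)) (alpha beta a : R) xs zs ys :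
  proper_fun f -> proper_fun g -> 0 <= a + beta ->
  (forall x : 'cV[R]_n, a * dot (M *m x) (M *m x) <= alpha * dot x x) ->
  strong_subdiff alpha f xs (- (M^T *m ys)) -> strong_subdiff beta g zs ys ->
  M *m xs = zs -> solution f g M xs zs.
Proof.
move=> fp gp ab0 aM [fx fsub] [gz gsub] Mx; split=> // x z xz.
have [A fA] := dom_fin fp fx; have [B gB] := dom_fin gp gz.
have := fsub x; have := gsub z; rewrite fA gB.
have := fp.1 x; have := gp.1 z.
case: (f x) => [b| |] //; case: (g z) => [c| |] //; rewrite ?leey //.
move=> _ _; rewrite -!EFinD !lee_fin dotNl -dotM.
have := aM (x - xs); rewrite mulmxBr Mx xz.
have := mulr_ge0 ab0 (dot_ge0 (z - zs)); lra.
Qed.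

End ADMM.

Theorem theorem5p2 (R : realType) (m n : nat) (M : 'M[R]_(m, n))
    (f : 'cV[R]_n -> \bar R) (g : 'cV[R]_m -> \bar R)
    (alpha beta gamma delta : R)
    (x0 : 'cV[R]_n) (z0 y0 : 'cV[R]_m)
    (x : nat -> 'cV[R]_n) (z y : nat -> 'cV[R]_m)
    (M_neq0 : M != 0)
    (f_proper : proper_fun f) (f_lsc : lower_semicontinuous f)
    (f_convex : alpha_convex alpha f)
    (g_proper : proper_fun g) (g_lsc : lower_semicontinuous g)
    (g_convex : alpha_convex beta g)
    (alpha_ge0 : 0 <= alpha)
    (alpha_beta_ge0 : 0 <= alpha + beta * norm2 M ^+ 2)
    (has_critical : exists xc zc yc, critical_point f g M xc zc yc)
    (ri_cond : ri (minkowski_sub (dom (fenchel f)) (ran M^T)) 0)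
    (delta_gt : Num.max 0 (- (2 * beta)) < delta)
    (gamma_eq : alpha + beta * norm2 M ^+ 2 = 0 -> gamma = delta + 2 * beta)
    (gamma_itv : 0 < alpha + beta * norm2 M ^+ 2 ->
       Num.max 0 (delta + 2 * beta - Delta M alpha beta delta) < gamma
         < delta + 2 * beta + Delta M alpha beta delta)
    (generated : aADMM f g M gamma delta x0 z0 y0 x z y) :
  exists (xs : 'cV[R]_n) (zs ys : 'cV[R]_m),
    [/\ critical_point f g M xs zs ys,
        M *m x k @[k --> \oo] --> M *m xs,
        z k @[k --> \oo] --> zs,
        y k @[k --> \oo] --> ys &
        solution f g M xs zs].
Proof.
have [_ _ _ step] := generated.
have kappa0 := norm2_gt0 M_neq0; set kappa := norm2 M in kappa0 *.
(* Modulus of [f] transported to the image of [M]; the hypothesis on [alpha] and [beta] becomes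
   [0 <= a + beta]. *)
pose a := alpha / kappa ^+ 2.
have k2 : 0 < kappa ^+ 2 by rewrite exprn_gt0.
have aE : alpha = a * kappa ^+ 2 by rewrite /a divfK // gt_eqF.
have abE : alpha + beta * kappa ^+ 2 = (a + beta) * kappa ^+ 2.
  by rewrite mulrDl -aE.
have ab0 : 0 <= a + beta by move: alpha_beta_ge0; rewrite -/kappa abE pmulr_lge0.
have a0 : 0 <= a by rewrite divr_ge0 // ltW.
have aM (v : 'cV[R]_n) : a * dot (M *m v) (M *m v) <= alpha * dot v v.
  by rewrite aE -mulrA ler_wpM2l // dot_norm2_le.
have [delta0 delta_beta] : 0 < delta /\ - (2 * beta) < delta.
  by move: delta_gt; rewrite gt_max => /andP.
have db2 : 0 < delta + 2 * beta by lra.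
have db0 : 0 < delta + beta by lra.
have [c c0 quad] : exists2 c, 0 < c & forall q r : 'cV[R]_m, c * dot r r <=
    (a + beta) * dot q q + (gamma - delta + 2 * a) * dot q r
    + (gamma + a - delta / 2) * dot r r.
  apply: quadratic_form_bound.
  have [ab|ab] := eqVneq (a + beta) 0; [left|right].
    have -> : gamma = delta + 2 * beta by apply: gamma_eq; rewrite -/kappa abE ab mul0r.
    by split=> //; split; lra.
  have {}ab : 0 < a + beta by rewrite lt_neqAle eq_sym ab.
  split=> //.
  have := gamma_itv; rewrite -/kappa abE mulr_gt0 // => /(_ isT).
  have DE : Delta M alpha beta delta ^+ 2 = 2 * (a + beta) * (delta + 2 * beta).
    rewrite /Delta -/kappa abE exprMn sqr_sqrtr; last first.
      by rewrite mulr_ge0 ?mulr_ge0 // ltW.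
    by field; rewrite gt_eqF.
  rewrite gt_max => /andP[/andP[_ lo] hi].
  move: DE lo hi; set D := Delta _ _ _ _ => DE lo hi.
  (* With the coefficients of [quad], [4 * A * D - B ^+ 2] of [quadratic_form_bound] equals [Delta
     ^+ 2 - (gamma - delta - 2 * beta) ^+ 2], the product of these two factors. *)
  have p1 : 0 < D - (gamma - delta - 2 * beta) by lra.
  have p2 : 0 < D + (gamma - delta - 2 * beta) by lra.
  by have := mulr_gt0 p1 p2; lra.
have xsub k : strong_subdiff alpha f (x k.+1)
    (- (M^T *m (y k + gamma *: (M *m x k.+1 - z k)))).
  by have [xmin _ _] := step k; exact: x_step_subdiff.
have zsub k : strong_subdiff beta g (z k.+1) (y k.+1).
  have [_ zmin ->] := step k.
  exact: z_step_subdiff f_proper (xsub k).1 g_proper g_convex zmin.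
pose s k := y k + delta *: z k.
(* Indices start one step late: [z0] and [y0] are arbitrary, and [y k] is known to be a subgradient
   at [z k] only from index 1 on. *)
pose r k := M *m x k.+2 - z k.+1.
pose V zc yc k := dot (s k.+1 - (yc + delta *: zc)) (s k.+1 - (yc + delta *: zc)).
have VE zc yc k : s k - (yc + delta *: zc) = (y k - yc) + delta *: (z k - zc).
  by rewrite /s opprD addrACA -scalerBr.
have descent xc zc yc k : strong_subdiff alpha f xc (- (M^T *m yc)) ->
    strong_subdiff beta g zc yc -> M *m xc = zc ->
    2 * delta * c * dot (r k) (r k) <= V zc yc k - V zc yc k.+1.
  move=> fc gc Mc.
  pose q := z k.+1 - zc; pose w := y k.+1 - yc.
  have Mq : M *m (x k.+2 - xc) = q + r k.
    by rewrite mulmxBr Mc /q /r [RHS]addrC addrA subrK.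
  have h1 : beta * dot q q <= dot w q := strong_subdiff_monotone g_proper (zsub k) gc.
  have h2 : a * dot (q + r k) (q + r k) <= - dot (w + gamma *: r k) (q + r k).
    rewrite -Mq; apply: le_trans (aM _) _.
    apply: le_trans (strong_subdiff_monotone f_proper (xsub k.+1) fc) _.
    by rewrite -opprD dotNl -mulmxN -mulmxDr -dotM /w addrAC.
  have := fejer_step delta0 h1 h2; have := quad q (r k).
  (* The multiplier update eliminates the new [z]: [s k.+2 = y k.+1 + delta *: (M *m x k.+2)]. *)
  have -> : w + delta *: (q + r k) = s k.+2 - (yc + delta *: zc).
    rewrite /s; have [_ _ ->] := step k.+1.
    apply/colP => i; rewrite /w /q /r !mxE; ring.
  rewrite -VE -/(V zc yc k) -/(V zc yc k.+1) => h3 h4.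
  by apply: le_trans h4; rewrite -mulrA ler_pM2l // mulr_gt0.
have z_bound zc yc k : strong_subdiff beta g zc yc ->
    (delta + beta) ^+ 2 * dot (z k.+1 - zc) (z k.+1 - zc) <= V zc yc k.
  move=> gc; rewrite /V VE; apply: resolvent_bound; first exact: ltW.
  exact: strong_subdiff_monotone g_proper (zsub k) gc.
have V_noninc xc zc yc : strong_subdiff alpha f xc (- (M^T *m yc)) ->
    strong_subdiff beta g zc yc -> M *m xc = zc ->
    nonincreasing_seq (V zc yc).
  move=> fc gc Mc; apply/nonincreasing_seqP => k.
  rewrite -subr_ge0; apply: le_trans (descent _ _ _ _ fc gc Mc).
  by rewrite !mulr_ge0 ?dot_ge0 // ltW.
have [xc [zc [yc [fc0 gc0 Mc0]]]] := has_critical.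
have fc := strong_subdiff_subdiff f_proper f_convex fc0.
have gc := frechet_strong_subdiff g_proper g_convex gc0.
have Mc : M *m xc = zc by apply/eqP; rewrite -subr_eq0 Mc0.
have r0 : r @ \oo --> (0 : 'cV[R]_m).
  apply: cvg_dot_sub0.
  have dc0 : 0 < 2 * delta * c by rewrite !mulr_gt0.
  have := @descent_cvg0 _ (V zc yc) (fun k => 2 * delta * c * dot (r k) (r k)).
  move=> /(_ (fun k => dot_ge0 _)) /(_ (fun k => mulr_ge0 (ltW dc0) (dot_ge0 _))).
  move=> /(_ (fun k => descent _ _ _ k fc gc Mc)) h.
  have -> : (fun k => dot (r k - 0) (r k - 0)) =
      (fun k => (2 * delta * c)^-1 * (2 * delta * c * dot (r k) (r k))).
    by apply/funext => k; rewrite mulrA mulVf ?mul1r ?subr0 // gt_eqF.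
  by rewrite -(mulr0 (2 * delta * c)^-1); apply: cvgM => //; exact: cvg_cst.
have V_le k : V zc yc k <= V zc yc 0%N by exact: (V_noninc _ _ _ fc gc Mc).
have z_bnd k : dot (z k.+1) (z k.+1) <=
    2 * (V zc yc 0%N / (delta + beta) ^+ 2) + 2 * dot zc zc.
  have : dot (z k.+1 - zc) (z k.+1 - zc) <= V zc yc 0%N / (delta + beta) ^+ 2.
    rewrite ler_pdivlMr ?exprn_gt0 // mulrC.
    exact: le_trans (z_bound _ _ _ gc) (V_le k).
  by have := dot_ge0 (z k.+1 - zc - zc); rewrite !dotE (dotC zc); lra.
have s_bnd k : dot (s k.+1) (s k.+1) <=
    2 * V zc yc 0%N + 2 * dot (yc + delta *: zc) (yc + delta *: zc).
  have := V_le k; rewrite {1}/V; move: (yc + _) (s k.+1) => u v.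
  by have := dot_ge0 (v - u - u); rewrite !dotE (dotC u); lra.
have [phi [zs [phioo zphi]]] := bounded_cvg_subseq z_bnd.
(* A second extraction makes [s] converge too; the limit of [y] is then read off as
   [ss - delta *: zs]. *)
have [psi [ss [psioo spsi]]] := bounded_cvg_subseq (fun k => s_bnd (phi k)).
pose tau := phi \o psi.
have ztau : z (tau k).+1 @[k --> \oo] --> zs := cvg_comp _ _ psioo zphi.
have tauoo : tau @ \oo --> \oo := cvg_comp _ _ psioo phioo.
pose ys := ss - delta *: zs.
have ytau : y (tau k).+1 @[k --> \oo] --> ys.
  have -> : (fun k => y (tau k).+1) =
      (fun k => s (phi (psi k)).+1 - delta *: z (tau k).+1).
    by apply/funext => k; rewrite /s addrK.
  by apply: cvgB => //; apply: cvgZ => //; exact: cvg_cst.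
have rtau : r (tau k) @[k --> \oo] --> (0 : 'cV[R]_m) := cvg_comp _ _ tauoo r0.
have gs : strong_subdiff beta g zs ys.
  by apply: (strong_subdiff_closed g_proper g_lsc ztau ytau); near=> k.
(* No bound on the [x k] is at hand, only the convergence of their images; the multipliers
   [y + gamma *: r] converge to [ys] because [r] tends to 0. *)
have [xs [fs Ms]] : exists xs, strong_subdiff alpha f xs (- (M^T *m ys)) /\
    M *m xs = zs.
  apply: (subdiff_limit_attained (xs := fun k => x (tau k).+2)
    (ps := fun k => y (tau k).+1 + gamma *: r (tau k))) => //.
  - have -> : (fun k => M *m x (tau k).+2) = (fun k => r (tau k) + z (tau k).+1).
      by apply/funext => k; rewrite /r subrK.
    by rewrite -[X in _ --> X]add0r; exact: cvgD.
  - rewrite -[X in _ --> X]addr0 -(scaler0 _ gamma); apply: cvgD => //.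
    by apply: cvgZ => //; exact: cvg_cst.
(* The descent holds for the critical point just built, so convergence along [tau] extends to the
   whole sequence. *)
have V0 : V zs ys @ \oo --> (0 : R).
  apply: (nonincreasing_subseq_cvg0 (phi := tau)); first exact: (V_noninc xs).
    by move=> k; exact: dot_ge0.
  have d : s (tau k).+1 - (ys + delta *: zs) @[k --> \oo] --> (0 : 'cV[R]_m).
    rewrite -(subrr (ys + delta *: zs)); apply: cvgB; last exact: cvg_cst.
    by apply: cvgD => //; apply: cvgZ => //; exact: cvg_cst.
  by rewrite -(dot0l (0 : 'cV[R]_m)); exact: (cvg_dot d d).
have z_lim : z k.+1 @[k --> \oo] --> zs.
  apply: cvg_dot_sub0.
  have Vd : V zs ys k / (delta + beta) ^+ 2 @[k --> \oo] --> 0.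
    by rewrite -(mul0r ((delta + beta) ^+ 2)^-1); apply: cvgM => //; exact: cvg_cst.
  apply: (squeeze_cvgr _ (@cvg_cst _ 0 _ _ _) Vd); apply: nearW => k.
  by rewrite dot_ge0 ler_pdivlMr ?exprn_gt0 // mulrC (z_bound _ _ _ gs).
have s_lim : s k.+1 @[k --> \oo] --> ys + delta *: zs by apply: cvg_dot_sub0.
have y_lim : y k.+1 @[k --> \oo] --> ys.
  have -> : (fun k => y k.+1) = (fun k => s k.+1 - delta *: z k.+1).
    by apply/funext => k; rewrite /s addrK.
  rewrite -(addrK (delta *: zs) ys); apply: cvgB => //.
  by apply: cvgZ => //; exact: cvg_cst.
have Mx_lim : M *m x k.+2 @[k --> \oo] --> M *m xs.
  have -> : (fun k => M *m x k.+2) = (fun k => r k + z k.+1).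
    by apply/funext => k; rewrite /r subrK.
  by rewrite Ms -[X in _ --> X]add0r; exact: cvgD.
exists xs, zs, ys; split.
- split; last by rewrite Ms subrr.
    exact: subdiff_strong_subdiff fs.
  exact: strong_subdiff_frechet g_proper gs.
- by rewrite -cvg_shiftS -cvg_shiftS.
- by rewrite -cvg_shiftS.
- by rewrite -cvg_shiftS.
- exact: strong_subdiff_solution f_proper g_proper ab0 aM fs gs Ms.
Unshelve. all: by end_near. Qed.
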